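(* Let $\mathbb S$ be the plane $\mathbb R\times\mathbb R$ with the topology generated by the rectangles $[a,b)\times[c,d)$, and let $\Delta_{\mathbb S}=\{(x,-x):x\in\mathbb R\}$. There is a partition of $\Delta_{\mathbb S}$ into pairwise disjoint sets $\Delta_{\mathbb S}(k)$, $k\in\mathbb Z$, each of which meets every dense $G_\delta$ subset of $\Delta_{\mathbb S}$ (with respect to the Euclidean topology on $\Delta_{\mathbb S}$), such that for the spaces $\mathbf Y_{\mathbb S}$ and $\mathbf Y_{\mathbb S}^*=\mathbf Y_{\mathbb S}\cup\{-\infty,+\infty\}$ constructed from $X=\mathbb S$ and these sets as described in the context, the following hold: $\mathbf Y_{\mathbb S}$ is completely regular; the subspaces $\mathbf Y_{\mathbb S}\cup\{-\infty\}$ and $\mathbf Y_{\mathbb S}\cup\{+\infty\}$ of $\mathbf Y_{\mathbb S}^*$ and the space $\mathbf Y_{\mathbb S}^*$ are regular; and if $f:\mathbf Y_{\mathbb S}^*\to\mathbb R$ is a continuous real valued function, then $f(+\infty)=f(-\infty)$.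
   Context: Regular and completely regular spaces are assumed to be $T_1$. General construction. Let $X$ be a space and $\Delta_X\subseteq X$ a closed discrete subset partitioned into sets $\Delta_X(k)$, $k\in\mathbb Z$. For $x\in X\setminus\Delta_X$ and $k\in\mathbb Z$ put $\mathbf x_k=(k,x)$; for $x\in\Delta_X(k)$ put $\mathbf x_k=\{(k,x),(k+1,x)\}$ (so for $x\in\Delta_X$ the point $\mathbf x_k$ is defined only for the unique $k$ with $x\in\Delta_X(k)$). Let $\mathbf Y=\mathbf Y_X$ be the set of all points $\mathbf x_k$ so defined. Its topology is generated by: the sets $\{\mathbf x_k:x\in V\}$, for $k\in\mathbb Z$ and $V\subseteq X\setminus\Delta_X$ open in $X$; and the sets $\{\mathbf x_k:x\in V\cap((X\setminus\Delta_X)\cup\Delta_X(k))\}\cup\{\mathbf x_{k+1}:x\in V\setminus\Delta_X\}$, for $k\in\mathbb Z$ and $V\subseteq X$ open. Put $\Delta_{\mathbf Y}(k)=\{\mathbf x_k:x\in\Delta_X(k)\}$ and $\mathbf Y_k=\{\mathbf x_k:x\in X\setminus\Delta_X\}$. In $\mathbf Y^*=\mathbf Y\cup\{-\infty,+\infty\}$ ($\pm\infty$ distinct new points), open sets of $\mathbf Y$ are open; the sets $\{+\infty\}\cup\bigcup\{\mathbf Y_n:n\geqslant m\}\cup\bigcup\{\Delta_{\mathbf Y}(n):n>m\}$, $m\in\mathbb Z$, form a base at $+\infty$; the sets $\{-\infty\}\cup\bigcup\{\mathbf Y_n:n\leqslant m\}\cup\bigcup\{\Delta_{\mathbf Y}(n):n<m\}$,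 $m\in\mathbb Z$, form a base at $-\infty$. *)

(* Defs.v *)
From HB Require Import structures.
From mathcomp Require Import all_boot all_order all_algebra.
From mathcomp Require Import finmap zify.
From mathcomp Require Import all_classical all_reals all_analysis.
Set Implicit Arguments.
Unset Strict Implicit.
Unset Printing Implicit Defensive.
Import Order.TTheory GRing.Theory Num.Theory.
Import numFieldNormedType.Exports.
Local Open Scope classical_set_scope.
Local Open Scope ring_scope.

(* Regular and completely regular spaces are required to be T_1, which the
   library predicates do not include. *)
Definition T1_regular (T : topologicalType) : Prop :=
  accessible_space T /\ @regular_space T.

Definition T1_completely_regular (T : topologicalType) : Prop :=
  accessible_space T /\ completely_regular_space T.

(* [completely_regular_space] is phrased with uniformities; this is the usual
   formulation with real-valued functions. *)
Lemma T1_completely_regularP (R : realType) (T : topologicalType) :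
  T1_completely_regular T <->
  accessible_space T /\
  forall (a : T) (B : set T), closed B -> ~ B a ->
    exists f : T -> R, [/\ continuous f, (forall x, 0 <= f x <= 1),
      f a = 0 & forall b, B b -> f b = 1].
Proof.
split=> -[T1 cr]; split=> // a B cB Ba.
  have /(@uniform_separatorP _ R)[f [cf f01 fa fB]] := cr a B cB Ba.
  exists f; split=> // [x||b Bb].
  - by have := f01 (f x) (imageT f x); rewrite /= in_itv.
  - by apply: fa; exists a.
  - by apply: fB; exists b.
have [f [cf f01 fa fB]] := cr a B cB Ba.
apply/(@uniform_separatorP _ R); exists f; split=> //.
- by move=> _ [x _ <-]; rewrite /= in_itv /= f01.
- by move=> _ [x -> <-].
- by move=> _ [b Bb <-]; exact: fB.
Qed.

Definition sorgenfrey_plane (R : realType) : Type := (R * R)%type.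

Definition half_open_rectangles (R : realType) :
    set (set (sorgenfrey_plane R)) :=
  [set A | exists a b c d : R,
     A = [set z | (a <= z.1 < b) && (c <= z.2 < d)]].

HB.instance Definition _ (R : realType) := gen_eqMixin (sorgenfrey_plane R).
HB.instance Definition _ (R : realType) := gen_choiceMixin (sorgenfrey_plane R).
HB.instance Definition _ (R : realType) :=
  isSubBaseTopological.Build (sorgenfrey_plane R)
    (@half_open_rectangles R) id.

Definition antidiagonal (R : realType) : set (R * R) :=
  [set z | z.2 = - z.1].
Arguments antidiagonal : clear implicits.

Section construction.
Variables (X : topologicalType) (D : int -> set X).

Definition Delta : set X := \bigcup_k D k.

(* The construction, for X and its subsets D k (the sets Delta_X(k)), makes
   sense without assuming that the D k are disjoint or that their union is
   closed and discrete.
   The point x_k of Y is encoded by the pair (k, x), also when x is in D k;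
   x_k exists iff x is outside Delta or x is in D k. *)
Record Yspace := YPoint {
  Ylevel : int;
  Ypoint : X;
  Ypoint_valid : (~` Delta `|` D Ylevel) Ypoint }.

HB.instance Definition _ := gen_eqMixin Yspace.
HB.instance Definition _ := gen_choiceMixin Yspace.

(* { x_k : x in A }, for the x in A such that x_k is defined *)
Definition Yslice (k : int) (A : set X) : set Yspace :=
  [set y | Ylevel y = k /\ A (Ypoint y)].

Definition Ysubbase : set (set Yspace) :=
  [set W | exists k V, [/\ open V, V `<=` ~` Delta & W = Yslice k V]] `|`
  [set W | exists k V, open V /\
     W = Yslice k (V `&` (~` Delta `|` D k)) `|` Yslice (k + 1) (V `\` Delta)].

HB.instance Definition _ := isSubBaseTopological.Build Yspace Ysubbase id.

Definition DeltaY (k : int) : set Yspace := Yslice k (D k).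
Definition Ycopy (k : int) : set Yspace := Yslice k (~` Delta).

Inductive Ystar := Yfin of Yspace | Yninfty | Ypinfty.

HB.instance Definition _ := gen_eqMixin Ystar.
HB.instance Definition _ := gen_choiceMixin Ystar.

Definition Ytail_pos (m : int) : set Yspace :=
  \bigcup_(n in [set n | m <= n]) Ycopy n `|`
  \bigcup_(n in [set n | m < n]) DeltaY n.

Definition Ytail_neg (m : int) : set Yspace :=
  \bigcup_(n in [set n | n <= m]) Ycopy n `|`
  \bigcup_(n in [set n | n < m]) DeltaY n.

Definition Ybase_pos (m : int) : set Ystar :=
  [set Ypinfty] `|` Yfin @` Ytail_pos m.
Definition Ybase_neg (m : int) : set Ystar :=
  [set Yninfty] `|` Yfin @` Ytail_neg m.

Definition Ystar_nbhs (p : Ystar) : set_system Ystar :=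
  match p with
  | Yfin y => Yfin @ nbhs y
  | Yninfty => filter_from setT Ybase_neg
  | Ypinfty => filter_from setT Ybase_pos
  end.

Lemma Ysubbase_open (W : set Yspace) : Ysubbase W -> open W.
Proof.
move=> sW; exists [set W]; last by rewrite bigcup_set1.
move=> _ ->; exists [fset W]%fset.
  by move=> i /fset1P ->; exact/mem_set.
by rewrite set_fset1 bigcap_set1.
Qed.

Definition Yband (n : int) : set Yspace :=
  Yslice n (~` Delta `|` D n) `|` Yslice (n + 1) (~` Delta).

Lemma Yband_open (n : int) : open (Yband n).
Proof.
apply: Ysubbase_open; right; exists n, setT; split; first exact: openT.
by rewrite setTI setTD.
Qed.

Lemma Ycopy_open (n : int) : open (Ycopy n).
Proof.
suff -> : Ycopy n = Yband n `&` Yband (n - 1).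
  by apply: openI; exact: Yband_open.
rewrite /Yband subrK; apply/seteqP; split=> [y [yn yD]|y].
  by split; [left; split=> //; left|right].
by move=> [] [] [y1 Dy1] [] [y2 Dy2] //; exfalso; lia.
Qed.

Lemma Ytail_pos_open (m : int) : open (Ytail_pos m).
Proof.
suff -> : Ytail_pos m = \bigcup_(n in [set n | m <= n]) Ycopy n `|`
    \bigcup_(n in [set n | m < n]) Yband n.
  by apply: openU; apply: bigcup_open => n _;
    [exact: Ycopy_open|exact: Yband_open].
apply/seteqP; split=> y [[n mn]|[n mn]].
- by move=> yn; left; exists n.
- by move=> [yn yD]; right; exists n => //; left; split=> //; right.
- by move=> yn; left; exists n.
move=> [[yn [yD|yD]]|[yn yD]]; first by left; exists n => //; exact: ltW.
  by right; exists n.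
by left; exists (n + 1) => //=; rewrite (le_trans (ltW mn))// lerDl.
Qed.

Lemma Ytail_neg_open (m : int) : open (Ytail_neg m).
Proof.
suff -> : Ytail_neg m = \bigcup_(n in [set n | n <= m]) Ycopy n `|`
    \bigcup_(n in [set n | n < m]) Yband n.
  by apply: openU; apply: bigcup_open => n _;
    [exact: Ycopy_open|exact: Yband_open].
apply/seteqP; split=> y [[n mn]|[n mn]].
- by move=> yn; left; exists n.
- by move=> [yn yD]; right; exists n => //; left; split=> //; right.
- by move=> yn; left; exists n.
move=> [[yn [yD|yD]]|[yn yD]]; first by left; exists n => //; exact: ltW.
  by right; exists n.
by left; exists (n + 1) => //=; rewrite lezD1.
Qed.

Lemma Ytail_posS (m n : int) : m <= n -> Ytail_pos n `<=` Ytail_pos m.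
Proof.
move=> mn y [] [k /= nk yk]; [left|right]; exists k => //=.
  exact: le_trans nk.
exact: le_lt_trans nk.
Qed.

Lemma Ytail_negS (m n : int) : m <= n -> Ytail_neg m `<=` Ytail_neg n.
Proof.
move=> mn y [] [k /= nk yk]; [left|right]; exists k => //=.
  exact: le_trans mn.
exact: lt_le_trans mn.
Qed.

Let Ystar_filter (p : Ystar) : ProperFilter (Ystar_nbhs p).
Proof.
case: p => [y||]; first exact: fmap_proper_filter.
- apply: filter_from_proper; last by move=> m _; exists Yninfty; left.
  apply: filter_from_filter; first by exists 0.
  move=> i j _ _; exists (Num.min i j) => // p [->|[y yt <-]].
    by split; left.
  by split; right; exists y => //; apply: Ytail_negS yt; rewrite ge_min lexx ?orbT.
- apply: filter_from_proper; last by move=> m _; exists Ypinfty; left.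
  apply: filter_from_filter; first by exists 0.
  move=> i j _ _; exists (Num.max i j) => // p [->|[y yt <-]].
    by split; left.
  by split; right; exists y => //; apply: Ytail_posS yt; rewrite le_max lexx ?orbT.
Qed.

Let Ystar_singleton (p : Ystar) (A : set Ystar) : Ystar_nbhs p A -> A p.
Proof.
by case: p => [y /= /nbhs_singleton//||] [m _]; apply; left.
Qed.

Let Ystar_nbhs_nbhs (p : Ystar) (A : set Ystar) :
  Ystar_nbhs p A -> Ystar_nbhs p (Ystar_nbhs^~ A).
Proof.
case: p => [y||].
- by move=> /= /nbhs_interior.
- move=> [m _ mA]; exists m => // q [->|[y yt <-]]; first by exists m.
  apply: (@filterS _ (nbhs y) _ (Ytail_neg m)).
    by move=> z zt; apply: mA; right; exists z.
  by apply: open_nbhs_nbhs; split=> //; exact: Ytail_neg_open.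
- move=> [m _ mA]; exists m => // q [->|[y yt <-]]; first by exists m.
  apply: (@filterS _ (nbhs y) _ (Ytail_pos m)).
    by move=> z zt; apply: mA; right; exists z.
  by apply: open_nbhs_nbhs; split=> //; exact: Ytail_pos_open.
Qed.

HB.instance Definition _ := hasNbhs.Build Ystar Ystar_nbhs.
HB.instance Definition _ := @Nbhs_isNbhsTopological.Build Ystar
  Ystar_filter Ystar_singleton Ystar_nbhs_nbhs.

End construction.

Arguments Yninfty {X D}.
Arguments Ypinfty {X D}.

(* Main.v *)
Require Import Defs.
From HB Require Import structures.
From mathcomp Require Import all_boot all_order all_algebra.
From mathcomp Require Import finmap zify lra.
From mathcomp Require Import all_classical all_reals all_analysis borel_hierarchy.
Set Implicit Arguments.
Unset Strict Implicit.
Unset Printing Implicit Defensive.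
Import Order.TTheory GRing.Theory Num.Theory.
Import numFieldNormedType.Exports.
Local Open Scope classical_set_scope.
Local Open Scope ring_scope.

(** The diagonal is partitioned by a Vitali construction rather than by
    transfinite induction.  Colour the rationals by integers so that every
    colour is dense in the line, choose a representative in each coset of the
    rationals, and give a real the colour of its rational difference with its
    representative.  Each colour class then meets every interval in a
    nonmeager set, since the rational translates of this intersection cover
    the line ([vitali_color_nonmeager]).

    The separation properties hold for every zero-dimensional T_1 space X in
    which each point has arbitrarily small clopen neighbourhoods that contain
    no other point of Delta.  Near a point y, the space Y is one sheet, or two
    sheets joined at y, over such a clopen set ([nbhs_YspaceP]), and this piece
    is clopen in Y ([Yblock_clopen]).  Hence Y is zero-dimensional.  A piece
    lies over at most two consecutive levels, so it stays closed in Y*, while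
    the closure of a tail at an infinite point is contained in any tail that
    starts two levels earlier; so Y* is regular ([Ystar_regular]).

    For the functions, let f be continuous with f <= a at the points of level
    k that lie over diagonal points with first coordinate in an open set J.
    Let a < a'. Each of these points has a Sorgenfrey square of some size
    1/(n+1), on the next sheet, where f < a'; as the class of colour k is
    nonmeager in J, for some n the points with this size are dense in an open
    set J'. A square at any point over J' meets one of these squares, on the
    sheet which the levels k and k + 1 share, so f <= a' at the points of
    level k + 1 over J' ([bounded_on_level_step]). Iterating with bounds that
    increase as little as desired carries f <= a from the tail at minus
    infinity to the tail at plus infinity, so f(+oo) <= f(-oo); the other
    inequality is the same one for - f. *)

(** * A partition of the line into nonmeager sets *)

(** The denominator [2 ^ i * 3 ^ j * 5 ^ n] receives the colour [i - j] for
    every [n]: the factors 2 and 3 choose the colour, and 5 makes the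
    denominator as large as desired. *)
Definition rat_color (q : rat) : int :=
  (logn 2 `|denq q|)%:Z - (logn 3 `|denq q|)%:Z.

Section vitali_partition.
Variable R : realType.

(** A numerator congruent to 1 modulo 30 is coprime to such a denominator, and
    the fractions with these numerators are spaced by 30 over the
    denominator. *)
Lemma rat_color_dense (k : int) (a b : R) : a < b ->
  exists2 q : rat, rat_color q = k & a < ratr q < b.
Proof.
move=> ab.
have [i [j kij]] : exists i j : nat, k = i%:Z - j%:Z.
  by case: k => n; [exists n, 0%N | exists 0%N, n.+1]; lia.
(* The numerator m below exceeds [a * d] by at most 31. *)
pose n := Num.bound (31 / (b - a)).
pose d := (2 ^ i * 3 ^ j * 5 ^ n)%N.
have d0 : (0 < d)%N by rewrite !muln_gt0 !expn_gt0.
have nd : (n <= d)%N.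
  rewrite (leq_trans (ltnW (ltn_expl n (isT : 1 < 5)%N)))//.
  by rewrite leq_pmull// muln_gt0 !expn_gt0.
have d0R : 0 < d%:R :> R by rewrite ltr0n.
have wide : 31 < (b - a) * d%:R.
  rewrite mulrC -ltr_pdivrMr ?subr_gt0//.
  apply: (lt_le_trans (archi_boundP _)).
    by rewrite divr_ge0// subr_ge0 ltW.
  by rewrite ler_nat.
pose t := Num.floor (a * d%:R / 30) + 1.
have /andP[t1 t2] : a * d%:R < 30 * t%:~R <= a * d%:R + 30.
  have /andP[h1 h2] := floor_itv (a * d%:R / 30).
  rewrite /t; move: h1 h2; rewrite intrD; set f := _%:~R.
  by rewrite ler_pdivlMr// ltr_pdivrMr// => h1 h2; apply/andP; split; lra.
pose m : int := 30 * t + 1.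
have cop (p e : nat) : p \in [:: 2; 3; 5]%N -> coprime `|m| (p ^ e).
  move=> p235; apply: coprimeXr.
  have pp : prime p by move: p235; rewrite !inE => /or3P[] /eqP->.
  rewrite coprime_sym prime_coprime//; apply/negP => pm.
  have : (p%:Z %| 1%Z)%Z.
    have -> : 1%Z = m - 30 * t by rewrite /m addrC addKr.
    rewrite rpredB//; apply: dvdz_mulr.
    by move: p235; rewrite !inE => /or3P[] /eqP->.
  by rewrite dvdz1 /=; move: p235; rewrite !inE => /or3P[] /eqP->.
have copd : coprime `|m| `|d%:Z|.
  by rewrite absz_nat /d !coprimeMr !cop.
exists (m%:~R / d%:Z%:~R).
  rewrite /rat_color coprimeq_den//.
  have -> : (if d%:Z == 0 then 1 else `|d%:Z|) = d%:Z.
    by case: eqP => //; lia.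
  rewrite absz_nat /d !lognM ?muln_gt0 ?expn_gt0// !lognX.
  rewrite (_ : logn 2 2 = 1%N)// (_ : logn 2 3 = 0%N)// (_ : logn 2 5 = 0%N)//.
  rewrite (_ : logn 3 2 = 0%N)// (_ : logn 3 3 = 1%N)// (_ : logn 3 5 = 0%N)//.
  by rewrite !muln0 !muln1 !addn0 add0n kij.
rewrite fmorph_div/= !ratr_int ltr_pdivlMr// ltr_pdivrMr//.
rewrite /m intrD intrM; apply/andP; split.
  by apply: (lt_trans t1); rewrite ltrDl.
by rewrite -[d%:~R]/(d%:R); move: t2 wide; set u := t%:~R; lra.
Qed.

Definition vitali_rep (x : R) : R :=
  xget 0 [set y | exists q : rat, y = x + ratr q].

Lemma vitali_repD (x : R) (q : rat) : vitali_rep (x + ratr q) = vitali_rep x.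
Proof.
rewrite /vitali_rep; congr (xget _ _); apply/seteqP; split=> y [r ->].
  by exists (q + r); rewrite rmorphD/= addrA.
by exists (r - q); rewrite rmorphB/= addrA addrAC addrK.
Qed.

Lemma vitali_offset_ex (x : R) : exists q : rat, x = vitali_rep x + ratr q.
Proof.
have [q ->] : exists q : rat, vitali_rep x = x + ratr q.
  apply: (@xgetPex _ 0 [set y | exists q : rat, y = x + ratr q]).
  by exists x, 0; rewrite rmorph0 addr0.
by exists (- q); rewrite rmorphN/= addrK.
Qed.

Definition vitali_offset (x : R) : rat := projT1 (cid (vitali_offset_ex x)).

Lemma vitali_offsetE (x : R) : x = vitali_rep x + ratr (vitali_offset x).
Proof. exact: projT2 (cid (vitali_offset_ex x)). Qed.

Lemma vitali_offsetD (x : R) (q : rat) :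
  vitali_offset (x + ratr q) = vitali_offset x + q.
Proof.
apply: (fmorph_inj (@ratr R)); rewrite rmorphD/=.
apply: (@addrI _ (vitali_rep x)).
by rewrite addrA -vitali_offsetE -(vitali_repD x q) -vitali_offsetE.
Qed.

Definition vitali_color (x : R) : int := rat_color (vitali_offset x).

(** Translation by a rational translates the offset, so the points of colour
    [k] are dense in each coset of the rationals. *)
Lemma vitali_color_translate (k : int) (x a b : R) : a < b ->
  exists q : rat, vitali_color (x + ratr q) = k /\ a < x + ratr q < b.
Proof.
move=> ab; have ab' : a - vitali_rep x < b - vitali_rep x by rewrite ltrD2r.
have [p pk pab] := rat_color_dense k ab'.
exists (p - vitali_offset x); rewrite /vitali_color vitali_offsetD addrC subrK.
split=> //.
have -> : x + ratr (p - vitali_offset x) = ratr p + vitali_rep x.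
  rewrite [X in X + _](vitali_offsetE x) -addrA -rmorphD/= addrC.
  by rewrite [_ + (p - _)]addrC subrK.
by move: pab; rewrite ltrBlDr ltrBrDr.
Qed.

Lemma open_addr_preimage (c : R) (A : set R) :
  open A -> open [set x | A (x + c)].
Proof.
by move=> oA; apply: (open_comp (f := fun x => x + c)) => // x _; apply: cvgD;
  [exact: cvg_id|exact: cvg_cst].
Qed.

(** By Baire some [x] lies in all the rational translates of all the [U i].
    The rational translates of [x] then belong to every [U i], and one of them
    has colour [k] and lies in [J]. *)
Lemma vitali_color_nonmeager (k : int) (U : nat -> set R) (J : set R) :
  (forall i, open (U i) /\ dense (U i)) -> open J -> J !=set0 ->
  exists x, [/\ J x, vitali_color x = k & forall i, U i x].
Proof.
move=> Uod oJ [j Jj].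
(* F lists the translates of the sets U i by all the rationals. *)
pose F n : set R := 
    if (choice.unpickle n : option (nat * rat)) is Some (i, q)
    then [set x | U i (x + ratr q)] else setT.
have Fod n : open (F n) /\ dense (F n).
  rewrite /F; case: (choice.unpickle n) => [[i q]|]; last first.
    by split; [exact: openT|move=> O O0 _; rewrite setIT].
  have [oU dU] := Uod i; split; first exact: open_addr_preimage.
  move=> O [y Oy] oO.
  have [|z [/= Oz Uz]] := dU _ _ (@open_addr_preimage (- ratr q) O oO).
    by exists (y + ratr q) => /=; rewrite addrK.
  by exists (z - ratr q); split=> //=; rewrite subrK.
have [x [_ Fx]] := Baire Fod (ex_intro _ 0 I) openT.
have [e /= e0 eJ] : nbhs_ball j J by apply/nbhs_ballP; exact: open_nbhs_nbhs.
have [q [qk /andP[jq qj]]] :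
    exists q : rat, vitali_color (x + ratr q) = k /\ j - e < x + ratr q < j + e.
  by apply: vitali_color_translate; lra.
exists (x + ratr q); split=> //.
  by apply: eJ; rewrite /ball/= ltr_norml; apply/andP; split; lra.
by move=> i; have := Fx (choice.pickle (i, q)) I; rewrite /F choice.pickleK.
Qed.

End vitali_partition.

(** * Topological preliminaries *)

(** The sets that belong to [F] contain the finite intersections of subbasic
    neighbourhoods of [t], hence all its neighbourhoods. *)
Lemma cvg_subbase (T : topologicalType) (S : set (set T)) (t : T)
    (F : set_system T) {FF : Filter F} :
  (forall W, open W ->
    exists2 B : set (set T), B `<=` finI_from S id & \bigcup_(A in B) A = W) ->
  (forall W, S W -> W t -> F W) -> F --> t.
Proof.
move=> gen SF A; rewrite nbhsE => -[W [/gen[B sB <-] [C BC Ct]] WA].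
apply: (@filterS _ F _ C) => [z Cz|]; first by apply: WA; exists C.
have [E sE CE] := sB _ BC; move: Ct; rewrite -CE => Et.
apply: filter_bigI => i iE; apply: SF; last exact: Et.
exact/set_mem/sE.
Qed.

(** The separating function is the indicator of the complement of a clopen
    set. *)
Lemma clopen_base_completely_regular (R : realType) (T : topologicalType) :
  accessible_space T ->
  (forall (x : T) W, nbhs x W -> exists C, [/\ clopen C, C x & C `<=` W]) ->
  T1_completely_regular T.
Proof.
move=> T1 base; apply/(@T1_completely_regularP R); split=> // a B cB Ba.
have [|C [[oC cC] Ca CB]] := base a (~` B).
  by apply: open_nbhs_nbhs; split=> //; exact: closed_openC.
exists (\1_(~` C)); split.
- move=> x; apply: cvg_near_cst; have [Cx|nCx] := pselect (C x).
    apply: filterS (open_nbhs_nbhs (conj oC Cx)) => y Cy.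
    by rewrite !indicE !memNset//= => /(_ _).
  apply: filterS (open_nbhs_nbhs (conj (closed_openC cC) nCx)) => y Cy.
  by rewrite !indicE !mem_set.
- by move=> x; rewrite indicE ler0n lern1 leq_b1.
- by rewrite indicE memNset//= => /(_ _).
- by move=> b Bb; rewrite indicE mem_set// => /CB.
Qed.

Lemma T1_regular_set_type (T : topologicalType) (A : set T) :
  T1_regular T -> T1_regular (set_type A).
Proof.
have cval : continuous (set_val : set_type A -> T).
  exact: (@initial_continuous (set_type A) T set_val).
move=> [T1 reg]; split=> [x y xy|a W].
  have [|B [oB Bx By]] := T1 (set_val x) (set_val y).
    by apply: contra_neq xy; exact: val_inj.
  exists (set_val @^-1` B); split.
  - by apply: open_comp => // z _; exact: cval.
  - by move: Bx; rewrite !inE.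
  - by move: By; rewrite !inE.
rewrite {1}nbhsE => -[_ [[B oB <-] Ba] BW].
have [U Ua UB] := reg (set_val a) B (open_nbhs_nbhs (conj oB Ba)).
exists (set_val @^-1` U); first exact: cval.
move=> p clp; apply: BW; apply: UB => N Np.
by have [q [Uq Nq]] := clp _ (cval p _ Np); exists (set_val q).
Qed.

(** * Separation properties of the construction *)

Section Yspace_topology.
Context (X : topologicalType) (D : int -> set X).
Hypothesis D_disj : trivIset setT D.
Hypothesis X_T1 : accessible_space X.
(* The last inclusion makes Delta closed and discrete. *)
Hypothesis X_base : forall x U, nbhs x U ->
  exists V, [/\ clopen V, V x, V `<=` U & V `&` Delta D `<=` [set x]].

Local Notation Y := (Yspace D).

Lemma Yspace_eq (y z : Y) : Ylevel y = Ylevel z -> Ypoint y = Ypoint z -> y = z.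
Proof.
case: y z => [k x p] [l w q] /= kl xw; move: p q; rewrite kl xw => p q.
by congr YPoint; exact: Prop_irrelevance.
Qed.

(** Over a point of Delta there is only one point, as the sets [D k] are
    disjoint. *)
Lemma Yspace_Delta_eq (y z : Y) :
  Delta D (Ypoint y) -> Ypoint y = Ypoint z -> y = z.
Proof.
move=> Dy yz; apply: Yspace_eq => //.
have DYl (u : Y) : Delta D (Ypoint u) -> D (Ylevel u) (Ypoint u).
  by case: (Ypoint_valid u).
apply: (D_disj I I); exists (Ypoint y); split; first exact: DYl.
by rewrite yz; apply: DYl; rewrite -yz.
Qed.

(** The sheets through [y]: besides [y], the points off Delta of its level, and
    those of the next level when [y] lies over Delta. *)
Definition Ysheets (y : Y) : set Y :=
  [set z | z = y \/ ~ Delta D (Ypoint z) /\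
    (Ylevel z = Ylevel y \/
     Delta D (Ypoint y) /\ Ylevel z = Ylevel y + 1)].

Definition Yblock (y : Y) (V : set X) : set Y :=
  Ysheets y `&` @Ypoint X D @^-1` V.

(** A subbasic open set contains, with [y], the part of the sheets of [y] over
    some neighbourhood.  Conversely, over an open set meeting Delta at most
    at the base point of [y], the sheets of [y] form a subbasic open set. *)
Lemma nbhs_YspaceP (y : Y) (W : set Y) :
  nbhs y W <-> exists2 V, nbhs (Ypoint y) V & Yblock y V `<=` W.
Proof.
split=> [|[V Vy VW]].
  have FF : Filter (filter_from (nbhs (Ypoint y)) (Yblock y)).
    apply: filter_from_filter; first by exists setT; exact: filterT.
    move=> A B Ay By; exists (A `&` B); first exact: filterI.
    by move=> z [sz [Az Bz]].
  suff : filter_from (nbhs (Ypoint y)) (Yblock y) --> y by exact.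
  apply: (@cvg_subbase _ (Ysubbase (D := D))) => // {}W.
  move=> [[k [V [oV VD ->]]] [yk Vy]|[k [V [oV ->]]] yW].
    exists V; first exact: open_nbhs_nbhs.
    move=> z [[->//|[zD [zy|[Dy _]]]] Vz]; last by case: (VD _ Vy).
    by split=> //; rewrite zy.
  exists V; first by apply: open_nbhs_nbhs; split=> //; case: yW => -[_ []].
  move=> z [[->//|[zD zy]] Vz].
  case: yW => -[yk [Vy yD]]; case: zy => [zy|[Dy zy]] //.
  - by left; split; [rewrite zy|split=> //; left].
  - by right; split; [rewrite zy yk|].
  - by right; split; [rewrite zy|].
have [C [[oC _] Cy CV CD]] := X_base Vy.
have [Dy|Dy] := pselect (Delta D (Ypoint y)).
  pose B := Yslice (Ylevel y) (C `&` (~` Delta D `|` D (Ylevel y))) `|`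
    Yslice (D := D) (Ylevel y + 1) (C `\` Delta D).
  have oB : open B by apply: Ysubbase_open; right; exists (Ylevel y), C.
  have By : B y by left; split=> //; split=> //; exact: Ypoint_valid.
  apply: filterS (open_nbhs_nbhs (conj oB By)) => z Bz; apply: VW.
  case: Bz => -[zy [Cz zD]]; split; try exact: CV.
    have [Dz|Dz] := pselect (Delta D (Ypoint z)).
      by left; apply: Yspace_eq => //; exact: CD.
    by right; split=> //; left.
  by right; split=> //; right.
have CND : C `<=` ~` Delta D by move=> x Cx Dx; apply: Dy; rewrite -(CD x).
have oB : open (Yslice (D := D) (Ylevel y) C).
  by apply: Ysubbase_open; left; exists (Ylevel y), C.
have By : Yslice (Ylevel y) C y by [].
apply: filterS (open_nbhs_nbhs (conj oB By)) => z [zy Cz]; apply: VW.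
by split; [right; split; [exact: CND|left]|exact: CV].
Qed.

Lemma Ypoint_continuous : continuous (@Ypoint X D).
Proof. by move=> y V Vy; apply/nbhs_YspaceP; exists V => // z []. Qed.

Lemma nbhs_Ysheets (y : Y) : nbhs y (Ysheets y).
Proof. by apply/nbhs_YspaceP; exists setT; [exact: filterT|move=> z []]. Qed.

(** A point outside the block either projects outside [V], or lies over [V].
    In the latter case it lies off Delta, since over [V] only [y] can lie over
    Delta; its only sheet is then disjoint from the sheets of [y]. *)
Lemma Yblock_clopen (y : Y) (V : set X) : clopen V -> V (Ypoint y) ->
  V `&` Delta D `<=` [set Ypoint y] -> clopen (Yblock y V).
Proof.
move=> [oV cV] Vy VD; split.
  rewrite openE => z [yz Vz]; apply/nbhs_YspaceP.
  exists V; first exact: open_nbhs_nbhs.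
  move=> w [wz Vw]; split=> //; case: wz => [->//|[Dw wz]].
  by case: yz wz => [->//|[Dz yz]]; [right|case=> [wz|[]//]; right; rewrite wz].
rewrite -[Yblock _ _]setCK; apply: open_closedC.
rewrite openE => z /= nz; apply/nbhs_YspaceP.
have [Vz|Vz] := pselect (V (Ypoint z)); last first.
  exists (~` V); first by apply: open_nbhs_nbhs; split=> //; exact: closed_openC.
  by move=> w [_ Vw] [_ /Vw].
exists setT; first exact: filterT.
have [Dz|Dz] := pselect (Delta D (Ypoint z)).
  exfalso; apply: nz; split=> //; left.
  by apply: Yspace_Delta_eq => //; exact: VD.
move=> w [zw _] [yw Vw]; apply: nz; split=> //.
case: zw => [<-//|[Dw [wz|[]//]]]; case: yw => [wy|[_ wy]].
  by right; split=> //; left; rewrite -wz wy.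
by right; split=> //; rewrite -wz.
Qed.

Lemma Yblock_base (y : Y) (W : set Y) : nbhs y W ->
  exists V, [/\ clopen (Yblock y V), Yblock y V y & Yblock y V `<=` W].
Proof.
move=> /nbhs_YspaceP[U Uy UW]; have [V [cV Vy VU VD]] := X_base Uy.
exists V; split; first exact: Yblock_clopen.
  by split=> //; left.
by move=> z [yz Vz]; apply: UW; split=> //; exact: VU.
Qed.

Lemma Yspace_T1 : accessible_space Y.
Proof.
move=> y z yz; have [pyz|pyz] := eqVneq (Ypoint y) (Ypoint z); last first.
  have [B [oB By Bz]] := X_T1 pyz; exists (@Ypoint X D @^-1` B); split.
  - by apply: open_comp => // w _; exact: Ypoint_continuous.
  - by move: By; rewrite !inE.
  - by move: Bz; rewrite !inE.
exists (Ysheets y)°; split; first exact: open_interior.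
  by rewrite inE; exact: nbhs_Ysheets.
rewrite inE => /interior_subset[/eqP|[Dz]]; first by rewrite eq_sym (negPf yz).
case=> [zy|[]]; last by rewrite pyz.
by move/eqP: yz; apply; exact: Yspace_eq.
Qed.

Lemma Yspace_completely_regular (R : realType) : T1_completely_regular Y.
Proof.
apply: (@clopen_base_completely_regular R); first exact: Yspace_T1.
by move=> y W /Yblock_base[V ?]; exists (Yblock y V).
Qed.

Lemma Ytail_posP (m : int) (y : Y) : m < Ylevel y -> Ytail_pos m y.
Proof.
move=> my; case: (Ypoint_valid y) => yD.
  by left; exists (Ylevel y) => //=; exact: ltW.
by right; exists (Ylevel y).
Qed.

Lemma Ytail_pos_level (m : int) (y : Y) : Ytail_pos m y -> m <= Ylevel y.
Proof. by move=> [] [n /= mn [-> _]] //; exact: ltW. Qed.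

Lemma Ytail_negP (m : int) (y : Y) : Ylevel y < m -> Ytail_neg m y.
Proof.
move=> my; case: (Ypoint_valid y) => yD.
  by left; exists (Ylevel y) => //=; exact: ltW.
by right; exists (Ylevel y).
Qed.

Lemma Ytail_neg_level (m : int) (y : Y) : Ytail_neg m y -> Ylevel y <= m.
Proof. by move=> [] [n /= mn [-> _]] //; exact: ltW. Qed.

Lemma Ysheets_level (y z : Y) :
  Ysheets y z -> Ylevel y <= Ylevel z <= Ylevel y + 1.
Proof. by move=> [->|[_ [->|[_ ->]]]]; rewrite ?lexx ?lerDl. Qed.

Lemma nbhs_Yfin (y : Y) (A : set Y) :
  nbhs y A -> nbhs (Yfin y : Ystar D) (@Yfin X D @` A).
Proof. by apply: (@filterS _ (nbhs y)) => w Aw; exists w. Qed.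

Lemma nbhs_Ypinfty (m : int) : nbhs (Ypinfty : Ystar D) (Ybase_pos m).
Proof. by exists m. Qed.

Lemma nbhs_Yninfty (m : int) : nbhs (Yninfty : Ystar D) (Ybase_neg m).
Proof. by exists m. Qed.

Lemma Ystar_T1 : accessible_space (Ystar D).
Proof.
move=> p q pq; suff [A pA qA] : exists2 A : set (Ystar D), nbhs p A & ~ A q.
  exists A°; split; first exact: open_interior.
    by rewrite inE.
  by rewrite inE => /interior_subset.
case: p q pq => [y||] [z||] pq; rewrite ?eqxx// in pq.
- have yz : y != z by apply: contra_neq pq => ->.
  have [B [oB By Bz]] := Yspace_T1 yz; exists (@Yfin X D @` B).
    by apply: nbhs_Yfin; apply: open_nbhs_nbhs; split=> //; move: By; rewrite inE.
  by move=> [w Bw [wz]]; move: Bz; rewrite inE -wz.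
- by exists (@Yfin X D @` setT); [apply: nbhs_Yfin; exact: filterT|case].
- by exists (@Yfin X D @` setT); [apply: nbhs_Yfin; exact: filterT|case].
- exists (Ybase_neg (Ylevel z - 1)); first exact: nbhs_Yninfty.
  by move=> [//|[w /Ytail_neg_level zw [wz]]]; move: zw; rewrite wz; lia.
- by exists (Ybase_neg 0); [exact: nbhs_Yninfty|move=> [//|[]]].
- exists (Ybase_pos (Ylevel z + 1)); first exact: nbhs_Ypinfty.
  by move=> [//|[w /Ytail_pos_level zw [wz]]]; move: zw; rewrite wz; lia.
- by exists (Ybase_pos 0); [exact: nbhs_Ypinfty|move=> [//|[]]].
Qed.

(** The sheets of a point [z] have the levels of [z] and possibly the next one.
    So the closure of a tail at plus infinity adds at most one level below,
    which is why the smaller tail starts two levels later: a point of level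
    [m] over Delta is not in the tail of [m].  At minus infinity a point in the
    closure has a level no larger than that of the tail, and one level
    suffices. *)
Lemma Ystar_regular : T1_regular (Ystar D).
Proof.
split; first exact: Ystar_T1.
case=> [y||] W.
- move=> /Yblock_base[V [[oC cC] Cy CW]]; exists (@Yfin X D @` Yblock y V).
    by apply: nbhs_Yfin; exact: open_nbhs_nbhs.
  case=> [z||] clz.
  + apply: CW; apply: cC => N Nz.
    have [_ [[w Cw <-] [v Nv [wv]]]] := clz _ (nbhs_Yfin Nz).
    by exists w; split=> //; rewrite -wv.
  + have [q [[w [yw _] <-]]] := clz _ (nbhs_Yninfty (Ylevel y - 1)).
    move=> [//|[v /Ytail_neg_level + [vw]]]; rewrite vw.
    by have := Ysheets_level yw; lia.
  + have [q [[w [yw _] <-]]] := clz _ (nbhs_Ypinfty (Ylevel y + 2)).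
    move=> [//|[v /Ytail_pos_level + [vw]]]; rewrite vw.
    by have := Ysheets_level yw; lia.
- move=> [m _ mW]; exists (Ybase_neg (m - 1)); first exact: nbhs_Yninfty.
  move=> p clp; apply: mW; case: p clp => [z||] clp; first 2 last.
  + have [q []] := clp _ (nbhs_Ypinfty m).
    move=> [->[//|[]//]|[w wm <-]] [//|[v vm [vw]]]; exfalso.
    by have := Ytail_neg_level wm; have := Ytail_pos_level vm; rewrite vw; lia.
  + right; exists z => //; apply: Ytail_negP.
    have [q []] := clp _ (nbhs_Yfin (nbhs_Ysheets z)).
    move=> [->[]//|[w /Ytail_neg_level wm <-]] [v zv [vw]].
    by have := Ysheets_level zv; rewrite vw; lia.
  + by left.
- move=> [m _ mW]; exists (Ybase_pos (m + 2)); first exact: nbhs_Ypinfty.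
  move=> p clp; apply: mW; case: p clp => [z||] clp.
  + right; exists z => //; apply: Ytail_posP.
    have [q []] := clp _ (nbhs_Yfin (nbhs_Ysheets z)).
    move=> [->[]//|[w /Ytail_pos_level wm <-]] [v zv [vw]].
    by have := Ysheets_level zv; rewrite vw; lia.
  + have [q []] := clp _ (nbhs_Yninfty m).
    move=> [->[//|[]//]|[w wm <-]] [//|[v vm [vw]]]; exfalso.
    by have := Ytail_pos_level wm; have := Ytail_neg_level vm; rewrite vw; lia.
  + by left.
Qed.

End Yspace_topology.

(** * The Sorgenfrey plane *)

Section sorgenfrey.
Variable R : realType.
Local Notation S := (sorgenfrey_plane R).

Definition sorgenfrey_square (z : S) (e : R) : set S :=
  [set w | (z.1 <= w.1 < z.1 + e) && (z.2 <= w.2 < z.2 + e)].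

Lemma sorgenfrey_square_refl (z : S) (e : R) : 0 < e -> sorgenfrey_square z e z.
Proof. by move=> e0; rewrite /sorgenfrey_square/= !lexx !ltrDl e0. Qed.

Lemma half_open_rectangle_open (W : set S) : half_open_rectangles W -> open W.
Proof.
move=> sW; exists [set W]; last by rewrite bigcup_set1.
move=> _ ->; exists [fset W]%fset.
  by move=> i /fset1P ->; exact/mem_set.
by rewrite set_fset1 bigcap_set1.
Qed.

Lemma sorgenfrey_square_open (z : S) (e : R) : open (sorgenfrey_square z e).
Proof.
by apply: half_open_rectangle_open; exists z.1, (z.1 + e), z.2, (z.2 + e).
Qed.

Lemma nbhs_sorgenfreyP (z : S) (U : set S) :
  nbhs z U <-> exists2 e, 0 < e & sorgenfrey_square z e `<=` U.
Proof.
split=> [|[e e0 eU]]; last first.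
  apply: filterS eU _; apply: open_nbhs_nbhs; split.
    exact: sorgenfrey_square_open.
  exact: sorgenfrey_square_refl.
have FF : Filter (filter_from [set e | 0 < e] (sorgenfrey_square z)).
  apply: filter_from_filter; first by exists 1 => /=.
  move=> e d /= e0 d0; exists (Num.min e d); first by rewrite /= lt_min e0.
  by move=> w; rewrite /sorgenfrey_square/= !addr_minr !lt_min; split; lra.
suff : filter_from [set e | 0 < e] (sorgenfrey_square z) --> z by exact.
apply: (@cvg_subbase _ (@half_open_rectangles R)) => // {}U.
move=> [a [b [c [d ->]]]] /= z_in.
exists (Num.min (b - z.1) (d - z.2)); first by rewrite /= lt_min; lra.
move=> w; rewrite /sorgenfrey_square/= !addr_minr !lt_min; lra.
Qed.

Lemma sorgenfrey_square_clopen (z : S) (e : R) : clopen (sorgenfrey_square z e).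
Proof.
split; first exact: sorgenfrey_square_open.
rewrite -[sorgenfrey_square _ _]setCK; apply: open_closedC.
rewrite openE => w /= /negP; rewrite !negb_and -!ltNge -!leNgt => wz.
apply/nbhs_sorgenfreyP.
have sep (A : set S) (d : R) : 0 < d ->
    (forall v, sorgenfrey_square w d v -> ~ A v) ->
    exists2 d, 0 < d & sorgenfrey_square w d `<=` ~` A.
  by move=> d0 dA; exists d.
case/orP: wz => /orP[] wz.
- apply: (sep _ (z.1 - w.1)); first by rewrite subr_gt0.
  by move=> v; rewrite /sorgenfrey_square/=; lra.
- apply: (sep _ 1) => // v; rewrite /sorgenfrey_square/=; lra.
- apply: (sep _ (z.2 - w.2)); first by rewrite subr_gt0.
  by move=> v; rewrite /sorgenfrey_square/=; lra.
- apply: (sep _ 1) => // v; rewrite /sorgenfrey_square/=; lra.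
Qed.

Lemma sorgenfrey_T1 : accessible_space S.
Proof.
move=> z w zw.
suff [e e0 we] : exists2 e, 0 < e & ~ sorgenfrey_square z e w.
  exists (sorgenfrey_square z e); split; first exact: sorgenfrey_square_open.
    by rewrite inE; exact: sorgenfrey_square_refl.
  by rewrite inE.
case: z w zw => [z1 z2] [w1 w2]; rewrite /sorgenfrey_square/=.
have [zw|zw|<-] := ltgtP z1 w1; [exists (w1 - z1); lra|exists 1; lra|].
have [zw|zw|<-] := ltgtP z2 w2; [exists (w2 - z2); lra|exists 1; lra|].
by rewrite eqxx.
Qed.

(** A square with its lower left corner on or above the antidiagonal meets it
    at most at this corner; from a corner below it, squares of side at most
    half the gap do not reach it. *)
Lemma sorgenfrey_base (z : S) (U : set S) : nbhs z U ->
  exists V, [/\ clopen V, V z, V `<=` U & V `&` antidiagonal R `<=` [set z]].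
Proof.
move=> /nbhs_sorgenfreyP[e e0 eU].
have sub (d : R) : d <= e -> sorgenfrey_square z d `<=` U.
  by move=> de w wz; apply: eU; move: wz; rewrite /sorgenfrey_square/=; lra.
have square (d : R) : 0 < d -> d <= e ->
    sorgenfrey_square z d `&` antidiagonal R `<=` [set z] ->
    exists V, [/\ clopen V, V z, V `<=` U & V `&` antidiagonal R `<=` [set z]].
  move=> d0 de dz; exists (sorgenfrey_square z d); split=> //.
  - exact: sorgenfrey_square_clopen.
  - exact: sorgenfrey_square_refl.
  - exact: sub.
have [z0|z0] := leP 0 (z.1 + z.2).
  apply: (square e) => // -[w1 w2] []; rewrite /sorgenfrey_square/antidiagonal/=.
  case: z z0 {eU sub square} => z1 z2 /= z0 + w2E.
  by rewrite w2E => wz; congr pair; lra.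
apply: (square (Num.min e (- (z.1 + z.2) / 2))).
- by rewrite lt_min e0; lra.
- by rewrite ge_min lexx.
move=> w []; rewrite /sorgenfrey_square/antidiagonal/= !addr_minr !lt_min.
by move=> wz w2E; exfalso; lra.
Qed.

End sorgenfrey.

(** * Continuous functions on the completed space *)

Section sorgenfrey_Yspace.
Variable R : realType.
Local Notation S := (sorgenfrey_plane R).

Definition vitali_part (k : int) : set S :=
  [set z | antidiagonal R z /\ vitali_color z.1 = k].
Local Notation Y := (Yspace vitali_part).

Lemma Delta_vitali_part : Delta vitali_part = antidiagonal R.
Proof.
by apply/seteqP; split=> [z [k _ []]//|z Az]; exists (vitali_color z.1).
Qed.

Lemma vitali_part_partition :
  partition [set: int] vitali_part (antidiagonal R).
Proof.
split; first exact: Delta_vitali_part.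
  by move=> k l _ _ [z [[_ <-] [_ <-]]].
move=> k _; have [q [qk _]] := vitali_color_translate k 0 (@ltr01 R).
by exists (0 + ratr q, - (0 + ratr q)).
Qed.

Lemma antidiagonal_point_subproof (x : R) : (x, - x) \in antidiagonal R.
Proof. exact: mem_set. Qed.

Definition antidiagonal_point (x : R) : set_type (antidiagonal R) :=
  exist _ (x, - x) (antidiagonal_point_subproof x).

Lemma antidiagonal_pointK (z : set_type (antidiagonal R)) :
  antidiagonal_point (set_val z).1 = z.
Proof.
case: z => -[a b] zA; apply: val_inj => /=.
by have : b = - a := set_mem zA; move=> ->.
Qed.

(** The projection to the first coordinate identifies the Euclidean
    antidiagonal with the line. *)
Lemma vitali_part_Gdelta (k : int) (G : set (set_type (antidiagonal R))) :
  Gdelta G -> dense G -> exists2 z, G z & vitali_part k (set_val z).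
Proof.
move=> [F oF GF] dG; pose U i := antidiagonal_point @^-1` F i.
have Uod i : open (U i) /\ dense (U i).
  split.
    have [B oB BF] := oF i; rewrite /U -BF.
    apply: (@open_comp _ _ (fun x : R => (x, - x)) B) => // x _.
    apply: (@cvg_pair _ _ _ (nbhs x) (nbhs x) (nbhs (- x)) _ _ _ id -%R).
      exact: cvg_id.
    exact: opp_continuous.
  move=> O [x Ox] oO.
  have [||z [Oz Gz]] := dG [set z | O (set_val z).1].
  - by exists (antidiagonal_point x).
  - exists [set z | O z.1] => //.
    by apply: (@open_comp _ _ (fun z : R * R => z.1) O) => // z _; exact: cvg_fst.
  exists (set_val z).1; split=> //; rewrite /U/= antidiagonal_pointK.
  by move: Gz; rewrite GF => /(_ i I).
have [x [_ xk Ux]] :=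
  vitali_color_nonmeager k Uod openT (ex_intro _ 0 I : setT !=set0).
by exists (antidiagonal_point x) => //; rewrite GF => i _; exact: Ux.
Qed.

Lemma vitali_point_valid (x : R) :
  (~` Delta vitali_part `|` vitali_part (vitali_color x)) (x, - x).
Proof. by right. Qed.

Definition Yvitali (x : R) : Y := YPoint (vitali_point_valid x).

Lemma nbhs_Yvitali (y : Y) (W : set Y) : nbhs y W ->
  exists2 e, 0 < e & Yblock y (sorgenfrey_square (Ypoint y) e) `<=` W.
Proof.
move=> /nbhs_YspaceP[].
  by move=> x U; rewrite Delta_vitali_part; exact: sorgenfrey_base.
move=> V /nbhs_sorgenfreyP[e e0 eV] VW; exists e => //.
by move=> z [yz /eV Vz]; exact: VW.
Qed.

(** [J] is a set of first coordinates, open for the Euclidean topology in the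
    uses below. *)
Definition bounded_on_level (f : Y -> R) (k : int) (a : R) (J : set R) :=
  forall y : Y, Delta vitali_part (Ypoint y) -> Ylevel y = k ->
    J (Ypoint y).1 -> f y <= a.

(** The Jones-type argument that also shows the Sorgenfrey plane not to be
    normal: squares of a fixed size at a dense set of diagonal points meet every
    square at a diagonal point. *)
Lemma bounded_on_level_step (f : Y -> R) (k : int) (a a' : R) (J : set R) :
  continuous f -> open J -> J !=set0 -> a < a' -> bounded_on_level f k a J ->
  exists J', [/\ open J', J' !=set0 & bounded_on_level f (k + 1) a' J'].
Proof.
move=> cf oJ J0 aa' fJ.
pose A (n : nat) : set R := [set x | forall w : Y,
  ~ Delta vitali_part (Ypoint w) -> Ylevel w = k + 1 ->
  sorgenfrey_square (x, - x) n.+1%:R^-1 (Ypoint w) -> f w < a'].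
(* Otherwise the complements of the closures of the A n are all dense, and
   some point of J of colour k belongs to none of the A n. *)
have [n [ O [[p [oO Op]] OA]]] : exists n, exists O,
    (exists p, open_nbhs p O) /\ O `&` ~` closure (A n) = set0.
  apply: contrapT => nA.
  have [i|x [Jx xk Ax]] := @vitali_color_nonmeager R k
      (fun n => ~` closure (A n)) J _ oJ J0.
    split; first exact/closed_openC/closed_closure.
    by apply: contrapT => /denseNE[ O ?]; apply: nA; exists i, O.
  have fx : f (Yvitali x) < a'.
    by apply: le_lt_trans aa'; apply: fJ => //; exists (vitali_color x).
  have [e e0 eW] := nbhs_Yvitali (cvgr_lt _ (cf (Yvitali x)) _ fx).
  apply: (Ax (Num.bound e^-1)); apply: subset_closure => w wD wk xw.
  apply: eW; split.
    by right; split=> //; right; split; [exists k|rewrite wk -xk].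
  move: xw; rewrite /sorgenfrey_square/=.
  set c := _.+1%:R^-1; suff : c < e by lra.
  rewrite invf_plt ?posrE//; apply: (lt_trans (archi_boundP _)).
    by rewrite invr_ge0 ltW.
  by rewrite ltr_nat.
have {}OA : O `<=` closure (A n).
  move=> x Ox; apply: contrapT => xA.
  by have : set0 x by rewrite -OA.
exists O; split=> //; first by exists p.
move=> y yD yk Oy; rewrite leNgt; apply/negP => fy.
have [e e0 eW] := nbhs_Yvitali (cvgr_gt _ (cf y) _ fy).
have yE : (Ypoint y).2 = - (Ypoint y).1.
  by move: yD; rewrite Delta_vitali_part.
set t := (Ypoint y).1 in Oy yE.
have [d /= d0 dO] : nbhs_ball t O.
  by apply/nbhs_ballP; exact: open_nbhs_nbhs.
pose c : R := n.+1%:R^-1; pose r := Num.min d (Num.min e c).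
have [rd re rc r0] : [/\ r <= d, r <= e, r <= c & 0 < r].
  by rewrite /r !ge_min !lt_min !lexx ?orbT d0 e0 invr_gt0 ltr0n.
have Om : O (t - r / 2).
  by apply: dO; rewrite /ball/= opprB addrC subrK gtr0_norm; lra.
have [|x [Ax]] := OA _ Om (ball (t - r / 2) (r / 2)).
  by apply: nbhsx_ballx; lra.
rewrite /ball/= ltr_norml => xt.
(* As x < t < x + r, the point (t, - x) lies above the diagonal and belongs to
   the squares at (x, - x) and at (t, - t). *)
have wD : ~ Delta vitali_part ((t, - x) : S).
  by rewrite Delta_vitali_part /antidiagonal/= => /oppr_inj; lra.
pose w : Y := @YPoint _ vitali_part (k + 1) ((t, - x) : S) (or_introl wD).
have : f w < a'.
  by apply: Ax => //; rewrite /sorgenfrey_square/= -/c; lra.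
have : a' < f w.
  apply: eW; split; first by right; split=> //; left.
  by rewrite /sorgenfrey_square/= -/t yE; lra.
lra.
Qed.

(** Each step costs an arbitrarily small increase of the bound, so any finite
    number of them does. *)
Lemma bounded_on_level_propagate (f : Y -> R) (k : int) (a : R) :
  continuous f -> bounded_on_level f k a setT ->
  forall (n : nat) a', a < a' ->
  exists J, [/\ open J, J !=set0 & bounded_on_level f (k + n%:Z) a' J].
Proof.
move=> cf fk; elim=> [|n IH] a' aa'.
  exists setT; split; [exact: openT|by exists 0|].
  move=> y yD yk _; apply/ltW/le_lt_trans/aa'.
  by apply: fk => //; rewrite yk addr0.
have [|J [oJ J0 fJ]] := IH ((a + a') / 2); first lra.
have [|J' [oJ' J'0 fJ']] := @bounded_on_level_step f _ _ a' J cf oJ J0 _ fJ.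
  lra.
by exists J'; split=> //; move: fJ'; rewrite -addrA -[n.+1]addn1 PoszD.
Qed.

(** Were f(-oo) < f(+oo), the bound f <= f(-oo) + (f(+oo) - f(-oo)) / 3 near
    minus infinity would propagate, with 2/3 in place of 1/3, to a level where
    f exceeds it. *)
Lemma Ystar_continuous_infty_le (f : Ystar vitali_part -> R) :
  continuous f -> f Ypinfty <= f Yninfty.
Proof.
move=> cf; rewrite leNgt; apply/negP => fN.
pose g (y : Y) := f (Yfin y).
have cg : continuous g by move=> y; exact: (cf (Yfin y)).
set a := f Yninfty in fN *; set b := f Ypinfty in fN *.
have [|m _ fm] := cvgr_lt _ (cf Yninfty) (a + (b - a) / 3).
  by rewrite -/a; lra.
have [|l _ fl] := cvgr_gt _ (cf Ypinfty) (a + 2 * (b - a) / 3).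
  by rewrite -/b; lra.
have gm : bounded_on_level g (m - 1) (a + (b - a) / 3) setT.
  move=> y _ yk _; apply: ltW; apply: fm; right; exists y => //.
  by apply: Ytail_negP; rewrite yk; lia.
have [|J [oJ J0 gJ]] := bounded_on_level_propagate cg gm
  (absz (l - m + 2)) (a' := a + 2 * (b - a) / 3); first lra.
set k := m - 1 + _ in gJ.
have [_|x [Jx xk _]] := @vitali_color_nonmeager R k (fun=> setT) J _ oJ J0.
  by split; [exact: openT|move=> O O0 _; rewrite setIT].
have : g (Yvitali x) <= a + 2 * (b - a) / 3.
  by apply: gJ => //; exists (vitali_color x).
rewrite leNgt => /negP; apply; apply: fl; right; exists (Yvitali x) => //.
by apply: Ytail_posP => /=; rewrite xk /k; lia.
Qed.

Lemma Ystar_continuous_infty_eq (f : Ystar vitali_part -> R) :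
  continuous f -> f Ypinfty = f Yninfty.
Proof.
move=> cf; apply/eqP; rewrite eq_le Ystar_continuous_infty_le//=.
rewrite -lerN2; apply: (@Ystar_continuous_infty_le (fun p => - f p)).
by move=> p; exact: (cvgN (cf p)).
Qed.

End sorgenfrey_Yspace.

(* The library's topology on the type [set_type A] is the subspace topology.
   [antidiagonal R] is a subset of the Euclidean plane [R * R] there. *)
Theorem mainTheorem6 (R : realType) :
  exists D : int -> set (sorgenfrey_plane R),
    [/\ partition [set: int] D (antidiagonal R),
        (forall (k : int) (G : set (set_type (antidiagonal R))),
           Gdelta G -> dense G -> exists2 z, G z & D k (set_val z)),
        T1_completely_regular (Yspace D),
        [/\ T1_regular (set_type [set~ (@Ypinfty _ D)]),
            T1_regular (set_type [set~ (@Yninfty _ D)]) &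
            T1_regular (Ystar D)] &
        forall f : Ystar D -> R, continuous f -> f Ypinfty = f Yninfty].
Proof.
exists (@vitali_part R).
have [_ disj _] := vitali_part_partition R.
have T1 := @sorgenfrey_T1 R.
have base (x : sorgenfrey_plane R) U : nbhs x U -> exists V,
    [/\ clopen V, V x, V `<=` U & V `&` Delta (@vitali_part R) `<=` [set x]].
  by rewrite Delta_vitali_part; exact: sorgenfrey_base.
have reg := Ystar_regular disj T1 base.
split.
- exact: vitali_part_partition.
- exact: vitali_part_Gdelta.
- exact: (Yspace_completely_regular disj T1 base R).
- by split=> //; exact: T1_regular_set_type.
- exact: Ystar_continuous_infty_eq.
Qed.
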